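(* Let $(!, \delta, \varepsilon, \partial)$ be a Cartesian differential comonad on a category $\mathbb{X}$ with finite biproducts. Then the following are equivalent: (i) the functor $\mathsf{F}_{\mathsf{D}\text{-}\mathsf{lin}} : \mathbb{X} \to \mathsf{D}\text{-}\mathsf{lin}[\mathbb{X}_!]$, defined on objects by $\mathsf{F}_{\mathsf{D}\text{-}\mathsf{lin}}(A)=A$ and on maps $f:A\to B$ by $[\![\mathsf{F}_{\mathsf{D}\text{-}\mathsf{lin}}(f)]\!]=f\circ\varepsilon_A$, is an isomorphism; (ii) $(!, \delta, \varepsilon, \partial)$ has a $\mathsf{D}$-linear unit $\eta_A : A \to !(A)$.
   Context: Composition is in classical order: $g \circ f$ means first $f$, then $g$. In a category with (chosen) finite products, $\pi_0,\pi_1$ are the projections of $A\times B$, $\langle f,g\rangle$ is pairing, $h\times k=\langle h\circ\pi_0,k\circ\pi_1\rangle$, and $\top$ is the terminal object. A category with finite biproducts has commutative monoid structure on hom-sets, and composition is bilinear. Define $\iota_0=\langle 1_A,0\rangle: A\to A\times B$, $\iota_1=\langle 0,1_B\rangle: B\to A\times B$, $\nabla_A=\pi_0+\pi_1: A\times A\to A$, $\ell_A=\iota_0\times\iota_1: A\times A\to (A\times A)\times(A\times A)$, $c_A=\langle\pi_0\times\pi_0,\pi_1\times\pi_1\rangle:(A\times A)\times(A\times A)\to(A\times A)\times(A\times A)$. coKleisli categories. For a comonad $(!,\delta,\varepsilon)$ on $\mathbb{X}$ ($\delta_A:!(A)\to !!(A)$, $\varepsilon_A:!(A)\to A$), the coKleisli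 category $\mathbb{X}_!$ has the objects of $\mathbb{X}$, and a map $f:A\to B$ in $\mathbb{X}_!$ is a map $[\![f]\!]:!(A)\to B$ in $\mathbb{X}$; $[\![g\circ f]\!]=[\![g]\!]\circ !([\![f]\!])\circ\delta_A$ and $[\![1_A]\!]=\varepsilon_A$. When $\mathbb{X}$ has finite biproducts, $\mathbb{X}_!$ has finite products and addition of maps: products on objects and $\top$ as in $\mathbb{X}$, $[\![\pi_j]\!]=\pi_j\circ\varepsilon_{A\times B}$, $[\![\langle f,g\rangle]\!]=\langle[\![f]\!],[\![g]\!]\rangle$, $[\![f+g]\!]=[\![f]\!]+[\![g]\!]$, $[\![0]\!]=0$. Cartesian differential comonads. Let $(!,\delta,\varepsilon)$ be a comonad on a category $\mathbb{X}$ with finite biproducts. A differential combinator transformation is a natural transformation $\partial_A:!(A\times A)\to !(A)$ with: [dc.1] $\partial_A\circ !(\iota_0)=0$; [dc.2] $\partial_A\circ !(1_A\times\nabla_A)=\partial_A\circ(!(1_A\times\pi_0)+!(1_A\times\pi_1))$; [dc.3] $\varepsilon_A\circ\partial_A=\pi_1\circ\varepsilon_{A\times A}$; [dc.4] $\delta_A\circ\partial_A=\partial_{!(A)}\circ !(\langle !(\pi_0),\partial_A\rangle)\circ\delta_{A\times A}$; [dc.5] $\partial_A\circ\partial_{A\times A}\circ !(\ell_A)=\partial_A$; [dc.6] $\partial_A\circ\partial_{A\times A}\circ !(c_A)=\partial_A\circ\partial_{A\times A}$. A Cartesian differential comonad is a quadruple $(!,\delta,\varepsilon,\partial)$ consisting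 of such a comonad and a differential combinator transformation. Its coKleisli category $\mathbb{X}_!$ is a Cartesian differential category with differential combinator $\mathsf{D}$ sending $[\![f]\!]:!(A)\to B$ to $[\![\mathsf{D}[f]]\!]=[\![f]\!]\circ\partial_A:!(A\times A)\to B$. A map $f: A\to B$ of $\mathbb{X}_!$ is $\mathsf{D}$-linear if $\mathsf{D}[f]=f\circ\pi_1$ (in $\mathbb{X}_!$), and $\mathsf{D}\text{-}\mathsf{lin}[\mathbb{X}_!]$ is the subcategory of $\mathbb{X}_!$ with the same objects and the $\mathsf{D}$-linear maps. For every $f$ in $\mathbb{X}$, the coKleisli map $f\circ\varepsilon_A$ is $\mathsf{D}$-linear, so $\mathsf{F}_{\mathsf{D}\text{-}\mathsf{lin}}$ is well defined. A $\mathsf{D}$-linear unit on $(!,\delta,\varepsilon,\partial)$ is a natural transformation $\eta_A:A\to !(A)$ such that [du.1] $\varepsilon_A\circ\eta_A=1_A$ and [du.2] $\eta_A\circ\varepsilon_A=\partial_A\circ !(\iota_1)$, where $\iota_1: A\to A\times A$. *)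

(* Defs.v *)
From Corelib Require Import ssreflect.
From Stdlib Require Import ProofIrrelevance.

Set Implicit Arguments.
Unset Strict Implicit.
Unset Printing Implicit Defensive.

Declare Scope cat_scope.
Delimit Scope cat_scope with cat.
Local Open Scope cat_scope.

(** * Categories, functors, natural transformations *)

Record category := Category {
  ob :> Type;
  hom : ob -> ob -> Type;
  idm : forall A, hom A A;
  comp : forall A B C, hom B C -> hom A B -> hom A C;
  comp1m : forall A B (f : hom A B), comp (idm B) f = f;
  compm1 : forall A B (f : hom A B), comp f (idm A) = f;
  compA : forall A B C D (h : hom C D) (g : hom B C) (f : hom A B),
    comp h (comp g f) = comp (comp h g) f
}.
Arguments hom {c} A B.
Arguments idm {c} A.
Arguments comp {c A B C} g f.

Notation "g ∘ f" := (comp g f)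
  (at level 40, left associativity) : cat_scope.

Record functor (C D : category) := Functor {
  fobj :> C -> D;
  fmap : forall A B : C, hom A B -> hom (fobj A) (fobj B);
  fmap1 : forall A : C, fmap (idm A) = idm (fobj A);
  fmapM : forall (A B E : C) (g : hom B E) (f : hom A B),
    fmap (g ∘ f) = fmap g ∘ fmap f
}.
Arguments fmap {C D} f {A B} _ : rename.

Definition functor_id (C : category) : functor C C :=
  @Functor C C (fun A => A) (fun _ _ f => f)
    (fun _ => eq_refl) (fun _ _ _ _ _ => eq_refl).

Definition functor_comp (C D E : category)
  (G : functor D E) (F : functor C D) : functor C E.
Proof.
refine (@Functor C E (fun A => G (F A)) (fun _ _ f => fmap G (fmap F f)) _ _).
- by move=> A; rewrite !fmap1.
- by move=> A B K g f; rewrite !fmapM.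
Defined.

(** Equality of functors is Leibniz equality, so this is isomorphism of
    categories and not mere equivalence. *)
Definition is_functor_iso (C D : category) (F : functor C D) : Prop :=
  exists G : functor D C,
    functor_comp G F = functor_id C /\ functor_comp F G = functor_id D.

Record nat_trans (C D : category) (F G : functor C D) := NatTrans {
  component :> forall A : C, hom (F A) (G A);
  naturality : forall (A B : C) (f : hom A B),
    component B ∘ fmap F f = fmap G f ∘ component A
}.

(** * Chosen finite products *)

Record cartesian_category := CartesianCategory {
  cart_cat :> category;
  top : cart_cat;
  to_top : forall A : cart_cat, hom A top;
  to_top_uniq : forall (A : cart_cat) (f : hom A top), f = to_top A;
  prod : cart_cat -> cart_cat -> cart_cat;
  pi0 : forall A B : cart_cat, hom (prod A B) A;
  pi1 : forall A B : cart_cat, hom (prod A B) B;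
  pair : forall Z A B : cart_cat, hom Z A -> hom Z B -> hom Z (prod A B);
  pi0_pair : forall (Z A B : cart_cat) (f : hom Z A) (g : hom Z B),
    pi0 A B ∘ pair f g = f;
  pi1_pair : forall (Z A B : cart_cat) (f : hom Z A) (g : hom Z B),
    pi1 A B ∘ pair f g = g;
  pair_uniq : forall (Z A B : cart_cat) (h : hom Z (prod A B)),
    h = pair (pi0 A B ∘ h) (pi1 A B ∘ h)
}.
Arguments top {c}.
Arguments to_top {c} A.
Arguments prod {c} A B.
Arguments pi0 {c A B}.
Arguments pi1 {c A B}.
Arguments pair {c Z A B} f g.

Notation "A × B" := (prod A B)
  (at level 40, left associativity) : cat_scope.
Notation "⟨ f , g ⟩" := (pair f g)
  (at level 0, f at level 99, g at level 99) : cat_scope.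

Definition prod_map (X : cartesian_category) (A B A' B' : X)
  (h : hom A A') (k : hom B B') : hom (A × B) (A' × B') :=
  ⟨ h ∘ pi0 , k ∘ pi1 ⟩.

Notation "h ×m k" := (prod_map h k)
  (at level 40, left associativity) : cat_scope.

Lemma pair_comp (X : cartesian_category) (Y Z A B : X)
  (f : hom Z A) (g : hom Z B) (h : hom Y Z) :
  ⟨ f , g ⟩ ∘ h = ⟨ f ∘ h , g ∘ h ⟩.
Proof. by rewrite [LHS]pair_uniq !compA pi0_pair pi1_pair. Qed.

Lemma pair_pi (X : cartesian_category) (A B : X) :
  ⟨ pi0 , pi1 ⟩ = idm (A × B).
Proof. by rewrite [RHS]pair_uniq !compm1. Qed.

Lemma prod_map_pair (X : cartesian_category) (Z A B A' B' : X)
  (h : hom A A') (k : hom B B') (f : hom Z A) (g : hom Z B) :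
  (h ×m k) ∘ ⟨ f , g ⟩ = ⟨ h ∘ f , k ∘ g ⟩.
Proof. by rewrite /prod_map pair_comp -!compA pi0_pair pi1_pair. Qed.

Definition square_functor (X : cartesian_category) : functor X X.
Proof.
refine (@Functor X X (fun A => A × A) (fun _ _ f => f ×m f) _ _).
- by move=> A; rewrite /prod_map !comp1m pair_pi.
- by move=> A B C g f; rewrite [in RHS]/(f ×m f) prod_map_pair /prod_map !compA.
Defined.

(** * Finite biproducts *)

(** The chosen terminal object is also initial, and each chosen product is
    also a coproduct.  The biproduct equations between projections and
    injections force the injections to be [⟨1,0⟩] and [⟨0,1⟩], so these are the
    maps required to form a coproduct cocone. *)
Record biproduct_category := BiproductCategory {
  biprod_cart :> cartesian_category;
  from_top : forall A : biprod_cart, hom top A;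
  from_top_uniq : forall (A : biprod_cart) (f : hom top A), f = from_top A;
  zero := fun A B : biprod_cart => from_top B ∘ to_top A;
  iota0 := fun A B : biprod_cart => ⟨ idm A , zero A B ⟩;
  iota1 := fun A B : biprod_cart => ⟨ zero B A , idm B ⟩;
  copair : forall A B Z : biprod_cart, hom A Z -> hom B Z -> hom (A × B) Z;
  copair_iota0 : forall (A B Z : biprod_cart) (f : hom A Z) (g : hom B Z),
    copair f g ∘ iota0 A B = f;
  copair_iota1 : forall (A B Z : biprod_cart) (f : hom A Z) (g : hom B Z),
    copair f g ∘ iota1 A B = g;
  copair_uniq : forall (A B Z : biprod_cart) (h : hom (A × B) Z),
    h = copair (h ∘ iota0 A B) (h ∘ iota1 A B)
}.
Arguments zero {b} A B.
Arguments iota0 {b A B}.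
Arguments iota1 {b A B}.
Arguments copair {b A B Z} f g.

(** The canonical addition on hom-sets: pairing followed by the codiagonal. *)
Definition add (X : biproduct_category) (A B : X) (f g : hom A B) : hom A B :=
  copair (idm B) (idm B) ∘ ⟨ f , g ⟩.

Notation "f +m g" := (add f g) (at level 50, left associativity) : cat_scope.

Section BiproductTheory.
Variable X : biproduct_category.
Implicit Types A B C : X.

Lemma comp0m A B C (f : hom A B) : zero B C ∘ f = zero A C.
Proof. by rewrite /zero -compA; congr (_ ∘ _); apply: to_top_uniq. Qed.

Lemma compm0 A B C (f : hom B C) : f ∘ zero A B = zero A C.
Proof. by rewrite /zero compA; congr (_ ∘ _); apply: from_top_uniq. Qed.

Lemma copair_comp A B C D (f : hom A C) (g : hom B C) (h : hom C D) :
  h ∘ copair f g = copair (h ∘ f) (h ∘ g).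
Proof. by rewrite [LHS]copair_uniq -!compA copair_iota0 copair_iota1. Qed.

Lemma add_comp A B C (f g : hom B C) (h : hom A B) :
  (f +m g) ∘ h = f ∘ h +m g ∘ h.
Proof. by rewrite /add -compA pair_comp. Qed.

Lemma comp_add A B C (f g : hom A B) (h : hom B C) :
  h ∘ (f +m g) = h ∘ f +m h ∘ g.
Proof.
rewrite /add compA -prod_map_pair compA; congr (_ ∘ _).
rewrite copair_comp compm1 [RHS]copair_uniq -!compA.
rewrite /iota0 /iota1 !prod_map_pair !compm0 !compm1.
have -> : ⟨ h , zero B C ⟩ = iota0 ∘ h by rewrite /iota0 pair_comp comp1m comp0m.
have -> : ⟨ zero B C , h ⟩ = iota1 ∘ h by rewrite /iota1 pair_comp comp1m comp0m.
by rewrite !compA copair_iota0 copair_iota1 comp1m.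
Qed.

Lemma addm0 A B (f : hom A B) : f +m zero A B = f.
Proof.
rewrite /add.
have -> : ⟨ f , zero A B ⟩ = iota0 ∘ f by rewrite /iota0 pair_comp comp1m comp0m.
by rewrite compA copair_iota0 comp1m.
Qed.

Lemma add0m A B (f : hom A B) : zero A B +m f = f.
Proof.
rewrite /add.
have -> : ⟨ zero A B , f ⟩ = iota1 ∘ f by rewrite /iota1 pair_comp comp1m comp0m.
by rewrite compA copair_iota1 comp1m.
Qed.

Lemma pair_add A B C (f f' : hom A B) (g g' : hom A C) :
  ⟨ f , g ⟩ +m ⟨ f' , g' ⟩ = ⟨ f +m f' , g +m g' ⟩.
Proof. by rewrite [LHS]pair_uniq !comp_add !pi0_pair !pi1_pair. Qed.

Lemma addACA A B (a b c d : hom A B) :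
  (a +m b) +m (c +m d) = (a +m c) +m (b +m d).
Proof.
transitivity (copair (idm B) (idm B) ∘ ⟨ a +m b , c +m d ⟩) => //.
by rewrite -pair_add comp_add.
Qed.

Lemma addC A B (f g : hom A B) : f +m g = g +m f.
Proof. by have := addACA (zero A B) f g (zero A B); rewrite !add0m !addm0. Qed.

Lemma addA A B (f g h : hom A B) : f +m (g +m h) = (f +m g) +m h.
Proof. by have := addACA f (zero A B) g h; rewrite add0m addm0. Qed.

End BiproductTheory.

Definition nabla (X : biproduct_category) (A : X) : hom (A × A) A := pi0 +m pi1.

Definition ell (X : biproduct_category) (A : X) :
  hom (A × A) ((A × A) × (A × A)) := iota0 ×m iota1.

Definition flip (X : biproduct_category) (A : X) :
  hom ((A × A) × (A × A)) ((A × A) × (A × A)) :=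
  ⟨ pi0 ×m pi0 , pi1 ×m pi1 ⟩.

(** * Comonads and coKleisli categories *)

Record comonad (X : category) := Comonad {
  bang :> functor X X;
  dig : nat_trans bang (functor_comp bang bang);
  der : nat_trans bang (functor_id X);
  der_dig : forall A : X, der (bang A) ∘ dig A = idm (bang A);
  fmap_der_dig : forall A : X, fmap bang (der A) ∘ dig A = idm (bang A);
  dig_dig : forall A : X,
    dig (bang A) ∘ dig A = fmap bang (dig A) ∘ dig A
}.

Section CoKleisli.
Variables (X : category) (T : comonad X).

Lemma der_nat (A B : X) (f : hom A B) : der T B ∘ fmap T f = f ∘ der T A.
Proof. exact: (naturality (der T) f). Qed.

Lemma dig_nat (A B : X) (f : hom A B) :
  dig T B ∘ fmap T f = fmap T (fmap T f) ∘ dig T A.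
Proof. exact: (naturality (dig T) f). Qed.

Definition cokleisli_comp (A B C : X) (g : hom (T B) C) (f : hom (T A) B) :
  hom (T A) C := g ∘ fmap T f ∘ dig T A.

Definition cokleisli : category.
Proof.
refine (@Category X (fun A B => hom (T A) B) (fun A => der T A)
          cokleisli_comp _ _ _).
- move=> A B f.
  by rewrite /cokleisli_comp der_nat -compA der_dig compm1.
- move=> A B f.
  by rewrite /cokleisli_comp -compA fmap_der_dig compm1.
- move=> A B C D h g f; rewrite /cokleisli_comp !fmapM -!compA.
  congr (_ ∘ (_ ∘ _)).
  by rewrite -dig_dig !compA dig_nat.
Defined.

End CoKleisli.

Definition cokleisli_cart (X : cartesian_category) (T : comonad X) :
  cartesian_category.
Proof.
refine (@CartesianCategory (cokleisli T)
  (top : X) (fun A => to_top (T A)) _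
  (fun A B : X => A × B)
  (fun A B => pi0 ∘ der T (A × B)) (fun A B => pi1 ∘ der T (A × B))
  (fun Z A B f g => ⟨ f , g ⟩) _ _ _).
- by move=> A f; apply: to_top_uniq.
- move=> Z A B f g /=; rewrite /cokleisli_comp.
  by rewrite -!compA [der T _ ∘ _]compA der_nat -compA der_dig compm1 pi0_pair.
- move=> Z A B f g /=; rewrite /cokleisli_comp.
  by rewrite -!compA [der T _ ∘ _]compA der_nat -compA der_dig compm1 pi1_pair.
- move=> Z A B h /=; rewrite /cokleisli_comp.
  by rewrite -!compA ![der T _ ∘ (_ ∘ _)]compA der_nat -compA der_dig compm1
             -pair_uniq.
Defined.

(** * Cartesian differential comonads *)

Section DiffCombTrans.
Variables (X : biproduct_category) (T : comonad X).
Variable d : nat_trans (functor_comp T (square_functor X)) T.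

Definition dc1 := forall A : X,
  d A ∘ fmap T iota0 = zero (T A) (T A).
Definition dc2 := forall A : X,
  d A ∘ fmap T (idm A ×m nabla A)
  = d A ∘ (fmap T (idm A ×m pi0) +m fmap T (idm A ×m pi1)).
Definition dc3 := forall A : X,
  der T A ∘ d A = pi1 ∘ der T (A × A).
Definition dc4 := forall A : X,
  dig T A ∘ d A = d (T A) ∘ fmap T ⟨ fmap T pi0 , d A ⟩ ∘ dig T (A × A).
Definition dc5 := forall A : X,
  d A ∘ d (A × A) ∘ fmap T (ell A) = d A.
Definition dc6 := forall A : X,
  d A ∘ d (A × A) ∘ fmap T (flip A) = d A ∘ d (A × A).

End DiffCombTrans.

Record cartesian_differential_comonad (X : biproduct_category) :=
  CartesianDifferentialComonad {
    cdc_comonad :> comonad X;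
    diff : nat_trans (functor_comp cdc_comonad (square_functor X)) cdc_comonad;
    diff_dc1 : dc1 diff;
    diff_dc2 : dc2 diff;
    diff_dc3 : dc3 diff;
    diff_dc4 : dc4 diff;
    diff_dc5 : dc5 diff;
    diff_dc6 : dc6 diff
  }.

Section DLinear.
Variables (X : biproduct_category) (T : cartesian_differential_comonad X).

Let K : cartesian_category := cokleisli_cart T.

Definition D (A B : K) (f : hom A B) : hom (A × A) B :=
  @comp X _ _ _ f (diff T A).

Definition D_linear (A B : K) (f : hom A B) : Prop := D f = f ∘ pi1.

Lemma diff_nat (A B : X) (f : hom A B) :
  diff T B ∘ fmap T (f ×m f) = fmap T f ∘ diff T A.
Proof. exact: (naturality (diff T) f). Qed.

Lemma D_linearE (A B : X) (f : @hom X (T A) B) :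
  @D_linear A B f <-> f ∘ diff T A = f ∘ fmap T pi1.
Proof.
rewrite /D_linear /D /= /cokleisli_comp fmapM -!compA fmap_der_dig compm1.
by [].
Qed.

Lemma D_linear_id (A : K) : D_linear (idm A).
Proof. by apply/D_linearE; rewrite /= der_nat; apply: diff_dc3. Qed.

Lemma diff_cokleisli_comp (A B C : X)
  (g : @hom X (T B) C) (f : @hom X (T A) B) :
  g ∘ diff T B = g ∘ fmap T pi1 -> f ∘ diff T A = f ∘ fmap T pi1 ->
  cokleisli_comp g f ∘ diff T A = cokleisli_comp g f ∘ fmap T pi1.
Proof.
move=> gl fl; rewrite /cokleisli_comp -!compA (diff_dc4 T) dig_nat !compA.
congr (_ ∘ _); rewrite -[g ∘ _ ∘ diff T _]compA -diff_nat compA gl.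
by rewrite -!compA -!fmapM prod_map_pair pi1_pair fl.
Qed.

Lemma D_linear_comp (A B C : K) (g : hom B C) (f : hom A B) :
  D_linear g -> D_linear f -> D_linear (g ∘ f).
Proof.
move=> /D_linearE gl /D_linearE fl; apply/D_linearE.
exact: diff_cokleisli_comp.
Qed.

Lemma D_linear_der (A B : X) (f : hom A B) :
  @D_linear A B (f ∘ der T A).
Proof.
by apply/D_linearE; rewrite -!compA der_nat; congr (_ ∘ _); apply: diff_dc3.
Qed.

Lemma D_lin_hom_eq (A B : K) (f g : {h : hom A B | D_linear h}) :
  proj1_sig f = proj1_sig g -> f = g.
Proof.
by case: f g => [f fl] [g gl] /= E; apply: subset_eq_compat.
Qed.

Definition D_lin : category.
Proof.
refine (@Category K (fun A B : K => {f : hom A B | D_linear f})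
  (fun A => exist _ (idm A) (D_linear_id A))
  (fun A B C g f => exist _ (proj1_sig g ∘ proj1_sig f)
                      (D_linear_comp (proj2_sig g) (proj2_sig f))) _ _ _).
- by move=> A B f; apply: D_lin_hom_eq; apply: comp1m.
- by move=> A B f; apply: D_lin_hom_eq; apply: compm1.
- by move=> A B C E h g f; apply: D_lin_hom_eq; apply: compA.
Defined.

Definition F_D_lin : functor X D_lin.
Proof.
refine (@Functor X D_lin (fun A => A)
  (fun A B f => exist _ (f ∘ der T A) (D_linear_der f)) _ _).
- by move=> A; apply: D_lin_hom_eq; exact: (@comp1m X).
- move=> A B C g f; apply: D_lin_hom_eq => /=.
  by rewrite /cokleisli_comp -!compA [der T B ∘ _]compA der_nat -!compA
             der_dig compm1.
Defined.

Record is_D_linear_unit (eta : nat_trans (functor_id X) T) : Prop := {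
  du1 : forall A : X, der T A ∘ eta A = idm A;
  du2 : forall A : X, eta A ∘ der T A = diff T A ∘ fmap T iota1
}.

Definition has_D_linear_unit : Prop :=
  exists eta : nat_trans (functor_id X) T, is_D_linear_unit eta.

End DLinear.

(* Main.v *)
From Corelib Require Import ssreflect.
From Stdlib Require Import FunctionalExtensionality ProofIrrelevance.
Require Import Defs.

Set Implicit Arguments.
Unset Strict Implicit.
Unset Printing Implicit Defensive.

Local Open Scope cat_scope.

(** Both conditions say that every D-linear coKleisli map [T A -> B] factors
    uniquely through the counit [ε_A : T A -> A].

    The functor is the identity on objects, so it is an isomorphism as soon as
    precomposition with [ε] is a bijection from [hom A B] to the D-linear maps.
    Given a D-linear unit [η], precomposition with [η] is the inverse: [du1]
    gives one cancellation, and a D-linear [f] satisfies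
    [f ∘ η ∘ ε = f ∘ ∂ ∘ T ι1 = f ∘ T π1 ∘ T ι1 = f]
    (lemma [D_linear_unit_factor]).

    Conversely, [∂_A ∘ T ι1 : T A -> T A] is always D-linear, being the
    derivative at zero of the universal coKleisli map [A -> T A]
    (lemma [derivative_at_zero_D_linear], which rests on the axioms [dc1],
    [dc2], [dc5] and [dc6]).  If the functor is full,
    this map is [η_A ∘ ε_A] for some [η_A], which is [du2]; and if it is
    faithful, [ε] can be cancelled on the right, which turns the naturality of
    [η] and [du1] into identities between maps out of [T A]. *)

Lemma functor_eq (C D : category) (o : C -> D)
  (m m' : forall A B : C, hom A B -> hom (o A) (o B)) m1 mM m1' mM' :
  (forall (A B : C) (f : hom A B), m A B f = m' A B f) ->
  @Functor C D o m m1 mM = @Functor C D o m' m1' mM'.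
Proof.
move=> E; have {}E : m = m'.
  apply: functional_extensionality_dep => A.
  apply: functional_extensionality_dep => B.
  exact: functional_extensionality.
case: _ / E m1' mM' => m1' mM'.
by rewrite (proof_irrelevance _ m1' m1) (proof_irrelevance _ mM' mM).
Qed.

Lemma fmap_inj_of_eq_id (C : category) (H : functor C C) :
  H = functor_id C ->
  forall (A B : C) (f g : hom A B), fmap H f = fmap H g -> f = g.
Proof. by move=> ->. Qed.

(** The preimage is produced as data by transport along the equality, so that
    a family of preimages can be formed without a choice principle. *)
Lemma fmap_preimage_of_eq_id (C : category) (H : functor C C) :
  H = functor_id C ->
  forall (A B : C) (h : hom (H A) (H B)), {f : hom A B | fmap H f = h}.
Proof. by move=> -> A B h; exists h. Qed.

Section InverseFunctors.
Variables (C D : category) (F : functor C D) (G : functor D C).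
Hypothesis GF : functor_comp G F = functor_id C.
Hypothesis FG : functor_comp F G = functor_id D.

Lemma iso_functor_faithful (A B : C) (f g : hom A B) :
  fmap F f = fmap F g -> f = g.
Proof. by move=> E; apply: (fmap_inj_of_eq_id GF); rewrite /= E. Qed.

(** The equalities of functors identify objects only propositionally, so [G h]
    is not a map [A -> B].  Lifting [G h] through [G F] and cancelling the
    faithful [G] avoids casts. *)
Lemma iso_functor_full (A B : C) (h : hom (F A) (F B)) :
  {f : hom A B | fmap F f = h}.
Proof.
have [f Ef] := fmap_preimage_of_eq_id GF (fmap G h : hom (functor_comp G F A) _).
by exists f; apply: (fmap_inj_of_eq_id FG); rewrite /= -Ef.
Qed.

End InverseFunctors.

Section Differential.
Variables (X : biproduct_category) (T : cartesian_differential_comonad X).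

Lemma comp_iota1 (A B : X) (f : hom A B) :
  (f ×m f) ∘ iota1 = iota1 ∘ f.
Proof. by rewrite /iota1 prod_map_pair pair_comp compm0 comp0m compm1 comp1m. Qed.

Lemma pair0m0 (Z A B : X) : ⟨ zero Z A , zero Z B ⟩ = zero Z (A × B).
Proof. by rewrite [RHS]pair_uniq !compm0. Qed.

(** Additivity of the derivative in its direction argument: [dc2] transported
    along an arbitrary base point [x] and arbitrary directions [y], [z]. *)
Lemma diff_pair_add (Z A : X) (x y z : hom Z A) :
  diff T A ∘ fmap T ⟨ x , y +m z ⟩
  = diff T A ∘ fmap T ⟨ x , y ⟩ +m diff T A ∘ fmap T ⟨ x , z ⟩.
Proof.
have := f_equal (fun h => h ∘ fmap T ⟨ x , ⟨ y , z ⟩ ⟩) (diff_dc2 T A).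
rewrite comp_add add_comp -!compA -!fmapM !prod_map_pair !comp1m.
by rewrite /nabla add_comp !pi0_pair !pi1_pair.
Qed.

Lemma diff_pair0 (Z A : X) (x : hom Z A) :
  diff T A ∘ fmap T ⟨ x , zero Z A ⟩ = zero (T Z) (T A).
Proof.
have -> : ⟨ x , zero Z A ⟩ = iota0 ∘ x by rewrite /iota0 pair_comp comp1m comp0m.
by rewrite fmapM compA (diff_dc1 T) comp0m.
Qed.

Lemma diff_diff_flip (Z A : X) (a b c d : hom Z A) :
  diff T A ∘ diff T (A × A) ∘ fmap T ⟨ ⟨ a , b ⟩ , ⟨ c , d ⟩ ⟩
  = diff T A ∘ diff T (A × A) ∘ fmap T ⟨ ⟨ a , c ⟩ , ⟨ b , d ⟩ ⟩.
Proof.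
rewrite -{1}(diff_dc6 T) -[LHS]compA -fmapM /flip pair_comp !prod_map_pair.
by rewrite !pi0_pair !pi1_pair.
Qed.

Lemma diff_diff_lift (Z A : X) (a d : hom Z A) :
  diff T A ∘ diff T (A × A) ∘ fmap T ⟨ ⟨ a , zero Z A ⟩ , ⟨ zero Z A , d ⟩ ⟩
  = diff T A ∘ fmap T ⟨ a , d ⟩.
Proof.
rewrite -[in RHS](diff_dc5 T) -[RHS]compA -fmapM /ell prod_map_pair.
by rewrite /iota0 /iota1 !pair_comp !comp1m !comp0m.
Qed.

(** Write [D(x,y)] for the derivative at the point [x] in the direction [y], and
    [D²] for its own derivative, whose points and directions are pairs.
    Naturality turns the left side into [D²((0,a),(0,b))], which equals
    [D²((0,0),(a,b))] by symmetry.  Additivity splits the direction as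
    [(a,b) = (a,0) + (0,b)].  By symmetry the first summand is
    [D²((0,a),(0,0)) = 0], and the second is [D(0,b)] by
    the lifting axiom [dc5]. *)
Lemma derivative_at_zero_D_linear (A : X) :
  diff T A ∘ fmap T iota1 ∘ diff T A
  = diff T A ∘ fmap T iota1 ∘ fmap T pi1.
Proof.
rewrite -compA -diff_nat compA -[in RHS]compA -fmapM /iota1 /prod_map.
rewrite !pair_comp !comp1m !comp0m diff_diff_flip.
rewrite -[in LHS](addm0 pi0) -[in LHS](add0m pi1) -pair_add.
rewrite -compA diff_pair_add comp_add !compA.
by rewrite diff_diff_lift diff_diff_flip pair0m0 -compA diff_pair0 compm0 add0m.
Qed.

Lemma D_linear_unit_factor (eta : nat_trans (functor_id X) T)
  (u : is_D_linear_unit eta) (A B : X) (f : @hom X (T A) B) :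
  @D_linear X T A B f -> f ∘ eta A ∘ der T A = f.
Proof.
move=> /D_linearE fl.
by rewrite -compA (du2 u) compA fl -compA -fmapM pi1_pair fmap1 compm1.
Qed.

Section UnitToInverse.
Variables (eta : nat_trans (functor_id X) T) (u : is_D_linear_unit eta).

Let inv_map (A B : D_lin T) (f : hom A B) : @hom X A B :=
  @comp X _ _ _ (proj1_sig f) (eta A).

Lemma inv_map1 (A : D_lin T) : inv_map (idm A) = @idm X A.
Proof. exact: (du1 u). Qed.

Lemma inv_mapM (A B C : D_lin T) (g : hom B C) (f : hom A B) :
  inv_map (g ∘ f) = @comp X _ _ _ (inv_map g) (inv_map f).
Proof.
case: g f => [g gl] [f fl]; rewrite /inv_map /= /cokleisli_comp.
(* Writing [f] as [f ∘ η ∘ ε] makes the comultiplication [δ] cancel against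
   [T ε]. *)
rewrite -{1}(D_linear_unit_factor u fl) fmapM -!compA.
rewrite [fmap T (der T A) ∘ _]compA fmap_der_dig comp1m.
by rewrite -(naturality eta (@comp X A (T A) B f (eta A))).
Qed.

Definition D_lin_inverse : functor (D_lin T) X :=
  @Functor (D_lin T) X (fun A => A) inv_map inv_map1 inv_mapM.

Lemma D_linear_unit_iso : is_functor_iso (F_D_lin T).
Proof.
exists D_lin_inverse; split; apply: functor_eq => A B f.
  by rewrite /= /inv_map /= -compA (du1 u) compm1.
by apply: D_lin_hom_eq; apply: (D_linear_unit_factor u (proj2_sig f)).
Qed.

End UnitToInverse.

Section InverseToUnit.
Hypothesis der_epi : forall (A B : X) (f g : hom A B),
  f ∘ der T A = g ∘ der T A -> f = g.
Variable e : forall A : X, hom A (T A).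
Hypothesis e_der : forall A : X, e A ∘ der T A = diff T A ∘ fmap T iota1.

Lemma derivative_at_zero_factor_nat (A B : X) (f : hom A B) :
  e B ∘ f = fmap T f ∘ e A.
Proof.
apply: der_epi; rewrite -[RHS]compA e_der -compA -(der_nat T f) [LHS]compA e_der.
by rewrite [RHS]compA -diff_nat -!compA -!fmapM comp_iota1.
Qed.

Lemma derivative_at_zero_factor_unit : has_D_linear_unit T.
Proof.
exists (@NatTrans X X (functor_id X) T e derivative_at_zero_factor_nat).
split=> A /=; last exact: e_der.
apply: der_epi; rewrite -compA e_der compA (diff_dc3 T) -compA der_nat.
by rewrite compA pi1_pair.
Qed.

End InverseToUnit.

Lemma iso_D_linear_unit : is_functor_iso (F_D_lin T) -> has_D_linear_unit T.
Proof.
case=> G [GF FG].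
have dl (A : X) : @D_linear X T A (T A) (diff T A ∘ fmap T iota1).
  by apply/D_linearE; apply: derivative_at_zero_D_linear.
pose e A := iso_functor_full GF FG (A := A) (B := T A) (exist _ _ (dl A)).
apply: (@derivative_at_zero_factor_unit _ (fun A => proj1_sig (e A))).
  move=> A B f g E; apply: (iso_functor_faithful GF).
  exact: D_lin_hom_eq.
by move=> A; have /(f_equal (@proj1_sig _ _)) := proj2_sig (e A).
Qed.

End Differential.

Theorem proposition3p11 (X : biproduct_category)
  (T : cartesian_differential_comonad X) :
  is_functor_iso (F_D_lin T) <-> has_D_linear_unit T.
Proof.
split; first exact: iso_D_linear_unit.
by case=> eta u; apply: (D_linear_unit_iso u).
Qed.
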